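(* Let $f,h:[a,b]\to\mathbb{R}$ be left-continuous on $(a,b]$. If $f$ and $h$ are $g$-differentiable on $[a,b]$ and $|f'_g(t)|\le h'_g(t)$ for all $t\in[a,b]$, then for each $I\in\mathcal{I}_1$, $$|f(s)-f(t)|\le|h(s)-h(t)|,\qquad s,t\in I.$$
   Context: Let $a<b$ be real numbers and let $g:\mathbb{R}\to\mathbb{R}$ be non-decreasing and left-continuous (a ''derivator''). Put $\Delta g(t)=g(t^+)-g(t)$, $D_g=\{t\in\mathbb{R}:\Delta g(t)>0\}$, and $C_g=\{t\in\mathbb{R}: g \text{ is constant on } (t-\varepsilon,t+\varepsilon)\text{ for some }\varepsilon>0\}$. The set $C_g$ is open; write $C_g=\bigcup_n (a_n,b_n)$ with $(a_n,b_n)$ its (pairwise disjoint) connected components. Put $N_g^-=\{a_n\}_n\setminus D_g$, $N_g^+=\{b_n\}_n\setminus D_g$. Standing assumption: $a\notin N_g^-$ and $b\notin N_g^+\cup D_g\cup C_g$. $g$-derivative: for $f:[a,b]\to\mathbb{R}$ and $t\in[a,b]$, $f'_g(t)=\lim_{s\to t}\frac{f(s)-f(t)}{g(s)-g(t)}$ if $t\notin D_g\cup C_g$; $f'_g(t)=\lim_{s\to t^+}\frac{f(s)-f(t)}{g(s)-g(t)}$ if $t\in D_g$; $f'_g(t)=\lim_{s\to b_n^+}\frac{f(s)-f(b_n)}{g(s)-g(b_n)}$ if $t\in(a_n,b_n)\subset C_g$; provided the limit exists (and is finite). Limits are taken over those $s\in[a,b]$ for which the denominator is nonzero. $f$ is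 $g$-differentiable on $[a,b]$ if $f'_g(t)$ exists for every $t\in[a,b]$. $\mathcal{I}_1$ denotes the family of connected components of $[a,b]\setminus C_g$. *)

(* Defs.v *)
From HB Require Import structures.
From mathcomp Require Import all_boot all_order all_algebra.
From mathcomp Require Import all_classical all_reals all_analysis.

Set Implicit Arguments.
Unset Strict Implicit.
Unset Printing Implicit Defensive.

Import Order.TTheory GRing.Theory Num.Theory.
Import numFieldNormedType.Exports.

Local Open Scope classical_set_scope.
Local Open Scope ring_scope.

Definition left_continuous_at (R : realType) (f : R -> R) (t : R) : Prop :=
  f s @[s --> t^'-] --> f t.

Definition derivator (R : realType) (g : R -> R) : Prop :=
  {homo g : x y / x <= y} /\ forall t, left_continuous_at g t.

Definition jump (R : realType) (g : R -> R) (t : R) : R :=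
  lim (g s @[s --> t^'+]) - g t.

Definition Dg (R : realType) (g : R -> R) : set R := [set t | 0 < jump g t].

Definition Cg (R : realType) (g : R -> R) : set R :=
  [set t | exists2 e : R, 0 < e &
     {in `]t - e, t + e[ &, forall x y, g x = g y}].

Definition Cg_comp (R : realType) (g : R -> R) (t : R) : set R :=
  connected_component (Cg g) t.

(* A component of Cg may be unbounded, and inf and sup are junk on such a set:
   only finite endpoints are collected in Ngm and Ngp. *)
Definition Ngm (R : realType) (g : R -> R) : set R :=
  [set x | exists2 t, Cg g t &
     has_lbound (Cg_comp g t) /\ x = inf (Cg_comp g t)] `\` Dg g.

Definition Ngp (R : realType) (g : R -> R) : set R :=
  [set x | exists2 t, Cg g t &
     has_ubound (Cg_comp g t) /\ x = sup (Cg_comp g t)] `\` Dg g.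

(* Functions on [a, b] are represented by total functions R -> R whose values
   outside [a, b] are never used: the g-derivative restricts the limit variable
   to gdom below. *)
Definition gdom (R : realType) (a b : R) (g : R -> R) (u : R) : set R :=
  [set s | a <= s <= b /\ g s - g u != 0].

(* If t lies in the component ]a_n, b_n[ of Cg then gbase g t = b_n. The sup is
   meaningful for t <= b as soon as b is not in Cg. Dg and Cg are disjoint for a
   derivator, so gbase g t = t on Dg. *)
Definition gbase (R : realType) (g : R -> R) (t : R) : R :=
  if t \in Cg g then sup (Cg_comp g t) else t.

Definition gfilter (R : realType) (a b : R) (g : R -> R) (t : R)
    : set_system R :=
  within (gdom a b g (gbase g t))
    (if t \in Dg g `|` Cg g then (gbase g t)^'+ else t^').

Definition gquot (R : realType) (g f : R -> R) (u s : R) : R :=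
  (f s - f u) / (g s - g u).

Definition gderivable (R : realType) (a b : R) (g f : R -> R) (t : R) : Prop :=
  cvg (gquot g f (gbase g t) s @[s --> gfilter a b g t]).

Definition gderive (R : realType) (a b : R) (g f : R -> R) (t : R) : R :=
  lim (gquot g f (gbase g t) s @[s --> gfilter a b g t]).

Definition I1 (R : realType) (a b : R) (g : R -> R) : set (set R) :=
  connected_component (`[a, b] `\` Cg g) @` (`[a, b] `\` Cg g).

(* Main.v *)
Require Import Defs.
From HB Require Import structures.
From mathcomp Require Import all_boot all_order all_algebra.
From mathcomp Require Import all_classical all_reals all_analysis.
From mathcomp Require Import lra.

(** The proof is the classical mean value inequality, carried out with
    right-hand limits only.  A subinterval of a component of [a, b] \ Cg does
    not meet Cg, so g is constant on no nondegenerate part of it, hence is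
    strictly increasing there ([derivator_lt_notin_Cg]).  This makes the
    denominators g s - g c nonzero for s to the right of c, so that the
    g-derivative at c, whether or not g jumps at c, is the right-hand limit of
    the difference quotient ([cvg_right_gderive]).

    Given s <= t in the component and e > 0, consider the property
      |f x - f s| <= (h x - h s) + e (g x - g s)
    of a point x of [s, t].  It holds at s; it passes to limits from the left
    because f, h and g are left-continuous; and when it holds at c it holds on
    a right neighbourhood of c because |f'_g c| <= h'_g c
    ([near_right_increment_le]).  Real induction carries it to t, and e -> 0
    gives |f t - f s| <= h t - h s.  Jumps of f, h or g are harmless: a jump
    occurs to the right of its point, where the quotient controls it. *)

Set Implicit Arguments.
Unset Strict Implicit.
Unset Printing Implicit Defensive.

Import Order.TTheory GRing.Theory Num.Theory.
Import numFieldNormedType.Exports.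

Local Open Scope classical_set_scope.
Local Open Scope ring_scope.

(** Real induction: the supremum of the x such that P holds on all of [s, x]
    can only be t. *)
Lemma real_induction (R : realType) (s t : R) (P : R -> Prop) :
  s <= t -> P s ->
  (forall c, s < c <= t -> (forall y, s <= y < c -> P y) -> P c) ->
  (forall c, s <= c < t -> P c -> \forall y \near c^'+, P y) ->
  P t.
Proof.
move=> st Ps Pleft Pright.
pose A := [set x | s <= x <= t /\ forall y, s <= y <= x -> P y].
have As : A s.
  split=> [|y /andP[sy ys]]; first by rewrite lexx.
  by have -> : y = s by apply/eqP; rewrite eq_le ys.
have supA : has_sup A by split; [exists s | exists t => x [/andP[]]].
have sc : s <= sup A by apply: ub_le_sup => //; case: supA.
have ct : sup A <= t by apply: ge_sup; [exists s | move=> x [/andP[]]].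
set c := sup A in sc ct.
have Pltc y : s <= y < c -> P y.
  move=> /andP[sy yc].
  have [|x [_ Px]] := @sup_adherent R A (c - y) _ supA.
    by rewrite subr_gt0.
  by rewrite subKr => yx; apply: Px; rewrite sy ltW.
have Pc : P c.
  have [sc'|sc'] := ltP s c; first by apply: Pleft => //; rewrite sc'.
  by have -> : c = s by apply/eqP; rewrite eq_le sc'.
have [ct'|tc] := ltP c t; last first.
  by have -> : t = c by apply/eqP; rewrite eq_le tc ct.
have [e /= e0 Pe] := Pright c (introT andP (conj sc ct')) Pc.
(* Both bounds matter: d < e keeps P valid, d <= t - c keeps c + d in [s, t]. *)
pose d := Num.min (e / 2) (t - c).
have d0 : 0 < d by rewrite lt_min subr_gt0 ct' divr_gt0.
have de : d < e by rewrite gt_min ltr_pdivrMr // ltr_pMr // ltr1n.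
have dt : d <= t - c by rewrite ge_min lexx orbT.
have Acd : A (c + d).
  split=> [|y /andP[sy ycd]]; first by lra.
  have [yc|cy|->//] := ltgtP y c; first by apply: Pltc; rewrite sy.
  by apply: Pe => //=; rewrite distrC ger0_norm; lra.
have : c + d <= c by apply: ub_le_sup => //; case: supA.
by lra.
Qed.

Lemma derivator_lt_notin_Cg (R : realType) (g : R -> R) (x y : R) :
  derivator g -> x < y -> (forall z, x < z < y -> ~ Cg g z) -> g x < g y.
Proof.
move=> [gle _] xy nC; rewrite lt_neqAle gle ?ltW// andbT.
apply/eqP => gxy; apply: (nC ((x + y) / 2)); first by lra.
exists ((y - x) / 2); first by lra.
have gE z : x < z < y -> g z = g x.
  move=> /andP[xz zy]; apply/eqP.
  by rewrite eq_le {1}gxy !gle ?ltW.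
move=> u v; rewrite !in_itv /= => /andP[u1 u2] /andP[v1 v2].
by rewrite !gE //; lra.
Qed.

(** Where g is strictly increasing to the right of c, the points to the right
    of c lie in the domain of the quotient, so the filter defining the
    g-derivative at c is coarser than the right neighbourhoods of c, on a jump
    of g and off it alike. *)
Lemma cvg_right_gderive (R : realType) (a b : R) (g f : R -> R) (c t : R) :
  a <= c -> c < t -> t <= b -> ~ Cg g c ->
  (forall y, c < y <= t -> g c < g y) ->
  gderivable a b g f c ->
  gquot g f c y @[y --> c^'+] --> gderive a b g f c.
Proof.
move=> ac ct tb nC gc.
have base : gbase g c = c by rewrite /gbase; case: ifPn => // /set_mem.
rewrite /gderivable /gderive base; apply: cvg_trans; apply: cvg_app.
have dom : \forall y \near c^'+, gdom a b g c y.
  near=> y.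
  have cy : c < y by near: y; exact: nbhs_right_gt.
  have yt : y <= t by near: y; exact: nbhs_right_ltW.
  split; first by lra.
  by rewrite subr_eq0 gt_eqF // gc // cy.
have cc : c^'+ `=>` (if c \in Dg g `|` Cg g then c^'+ else c^').
  case: ifP => _ //.
  move=> P; rewrite /dnbhs /at_right /within /= => h.
  by near=> y => cy; move: (near h y); apply => //; rewrite gt_eqF.
rewrite /gfilter base => P /cc; rewrite /within /= => h.
by near=> y; apply: (near h y) => //; near: y.
Unshelve. all: by end_near. Qed.

(** If quotients of f and h have right-hand limits df and dh at c, the
    quotient of f is at most |df| + e/2 in absolute value and that of h at
    least dh - e/2; the two errors add up to e. *)
Lemma near_right_increment_le (R : realType) (g f h : R -> R) (c df dh e : R) :
  0 < e -> `|df| <= dh -> (\forall y \near c^'+, g c < g y) ->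
  gquot g f c y @[y --> c^'+] --> df ->
  gquot g h c y @[y --> c^'+] --> dh ->
  \forall y \near c^'+, `|f y - f c| <= h y - h c + e * (g y - g c).
Proof.
move=> e0 dfh gc /cvgrPdist_lt cf /cvgrPdist_lt ch.
have e20 : 0 < e / 2 by rewrite divr_gt0.
near=> y.
have gy : 0 < g y - g c by rewrite subr_gt0; near: y.
have fy : `|df - gquot g f c y| < e / 2 by near: y; exact: cf.
have hy : `|dh - gquot g h c y| < e / 2 by near: y; exact: ch.
have mulq (k : R -> R) : k y - k c = gquot g k c y * (g y - g c).
  by rewrite /gquot divfK // gt_eqF.
rewrite (mulq f) (mulq h) normrM (gtr0_norm gy) -mulrDl ler_pM2r //.
have := ler_distD df 0 (gquot g f c y).
rewrite !sub0r !normrN => fle.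
move: hy; rewrite ltr_norml => /andP[_ hy].
by lra.
Unshelve. all: by end_near. Qed.

(** Mean value inequality with respect to a strictly increasing g, from
    right-hand limits of quotients and left-continuity. *)
Lemma mean_value_increment_le (R : realType) (g f h df dh : R -> R) (s t : R) :
  s <= t ->
  (forall x y, s <= x -> x < y -> y <= t -> g x < g y) ->
  (forall c, s < c <= t -> left_continuous_at g c) ->
  (forall c, s < c <= t -> left_continuous_at f c) ->
  (forall c, s < c <= t -> left_continuous_at h c) ->
  (forall c, s <= c < t -> gquot g f c y @[y --> c^'+] --> df c) ->
  (forall c, s <= c < t -> gquot g h c y @[y --> c^'+] --> dh c) ->
  (forall c, s <= c < t -> `|df c| <= dh c) ->
  `|f t - f s| <= h t - h s.
Proof.
move=> st gm gl fl hl fq hq dfh.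
have approx e : 0 < e -> `|f t - f s| <= h t - h s + e * (g t - g s).
  move=> e0.
  pose P x := `|f x - f s| <= h x - h s + e * (g x - g s).
  apply: (@real_induction R s t P) => //.
  - by rewrite /P !subrr normr0 mulr0 addr0.
  - move=> c sct Plt; have sc : s < c by case/andP: sct.
    have cf : `|f x - f s| @[x --> c^'-] --> `|f c - f s|.
      by apply: cvg_norm; apply: cvgB; [exact: fl | exact: cvg_cst].
    have ch : h x - h s + e * (g x - g s) @[x --> c^'-] -->
              h c - h s + e * (g c - g s).
      apply: cvgD; first by apply: cvgB; [exact: hl | exact: cvg_cst].
      apply: cvgMr; apply: cvgB; [exact: gl | exact: cvg_cst].
    apply: (ler_cvg_to cf ch); near=> x; apply: Plt; apply/andP; split.
      by apply/ltW; near: x; exact: nbhs_left_gt.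
    by near: x; exact: nbhs_left_lt.
  - move=> c sct Pc; have /andP[sc ct] := sct.
    have gc : \forall y \near c^'+, g c < g y.
      near=> y; have cy : c < y by near: y; exact: nbhs_right_gt.
      by apply: gm => //; near: y; exact: nbhs_right_ltW.
    have := near_right_increment_le e0 (dfh c sct) gc (fq c sct) (hq c sct).
    apply: filterS => y Py; rewrite /P.
    move: Pc; rewrite /P => Pc.
    have := ler_distD (f c) (f y) (f s).
    by rewrite !mulrBr in Pc Py *; lra.
apply/ler_addgt0Pr => e e0.
(* The + 1 keeps the denominator positive when s = t. *)
have g0 : 0 <= g t - g s.
  by rewrite subr_ge0; move: st; rewrite le_eqVlt => /orP[/eqP->//|?];
     apply/ltW/gm.
apply: (le_trans (approx (e / (g t - g s + 1)) _)).
  by rewrite divr_gt0 // ltr_wpDl.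
by rewrite lerD2l mulrAC ler_pdivrMr ?ltr_wpDl // ler_pM2l // lerDl.
Unshelve. all: by end_near. Qed.

Theorem theorem3p12 (R : realType) (a b : R) (g f h : R -> R)
  (hab : a < b)
  (hg : derivator g)
  (ha : ~ Ngm g a)
  (hb : ~ (Ngp g `|` Dg g `|` Cg g) b)
  (hfl : forall t, a < t <= b -> left_continuous_at f t)
  (hhl : forall t, a < t <= b -> left_continuous_at h t)
  (hfd : forall t, a <= t <= b -> gderivable a b g f t)
  (hhd : forall t, a <= t <= b -> gderivable a b g h t)
  (hfh : forall t, a <= t <= b ->
     `|gderive a b g f t| <= gderive a b g h t) :
  forall I : set R, I1 a b g I ->
  forall s t : R, I s -> I t -> `|f s - f t| <= `|h s - h t|.
Proof.
move=> _ [z _ <-] s t.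
wlog st : s t / s <= t => [wl Is It|Is It].
  have [st|/ltW ts] := leP s t; first exact: wl.
  by rewrite distrC (distrC (h s)); exact: wl.
have /connected_intervalP Iitv :=
  @component_connected R (`[a, b] `\` Cg g) z.
have sub x : s <= x <= t -> a <= x <= b /\ ~ Cg g x.
  move=> sxt; have /connected_component_sub[] := Iitv _ _ Is It _ sxt.
  by rewrite /= in_itv.
have [/andP[sa _] _] := sub s (introT andP (conj (lexx s) st)).
have [/andP[_ tb] _] := sub t (introT andP (conj st (lexx t))).
have gm x y : s <= x -> x < y -> y <= t -> g x < g y.
  move=> sx xy yt; apply: derivator_lt_notin_Cg => // w xwy.
  by have [] := sub w; first by lra.
have quot k c : gderivable a b g k c -> s <= c < t ->
    gquot g k c y @[y --> c^'+] --> gderive a b g k c.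
  move=> kd /andP[sc ct]; apply: (cvg_right_gderive (t := t)) => //.
  - exact: le_trans sc.
  - by have [] := sub c; first by lra.
  - by move=> y /andP[cy yt]; exact: gm.
rewrite distrC (distrC (h s)); apply: le_trans (ler_norm _).
apply: (mean_value_increment_le (df := gderive a b g f)
  (dh := gderive a b g h) st gm).
- by move=> c _; exact: hg.2.
- by move=> c sct; apply: hfl; lra.
- by move=> c sct; apply: hhl; lra.
- by move=> c sct; apply: quot => //; apply: hfd; lra.
- by move=> c sct; apply: quot => //; apply: hhd; lra.
- by move=> c sct; apply: hfh; lra.
Qed.
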